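(* Let $G$ be a graph with no isolated vertex that is not a disjoint union of copies of $K_2$, and let $H$ be any nontrivial graph with root $v\in V(H)$. The following statements are equivalent: (i) $\gamma_R(G\circ_v H)=\gamma_R(G)+n(G)(\gamma_R(H)-1)$; (ii) $\gamma_R(H-v)=\gamma_R(H)-1$ and $g(v)\leq 1$ for every Roman dominating function $g$ on $H$ of weight $\gamma_R(H)$.
   Context: All graphs are finite and simple; a graph is nontrivial if it has at least two vertices; $n(G)=|V(G)|$; $K_2$ is the graph with one edge. For a graph $G$ and a nontrivial graph $H$ with a root $v\in V(H)$, the rooted product graph $G\circ_v H$ is obtained by taking one copy of $G$ and $n(G)$ copies of $H$, and identifying the $i$-th vertex of $G$ with the vertex $v$ in the $i$-th copy of $H$, for each $i$. $H-v$ is $H$ with $v$ deleted. A Roman dominating function on a graph $X$ is $f:V(X)\to\{0,1,2\}$ such that every vertex with value $0$ has a neighbor with value $2$; its weight is $\sum_u f(u)$, and $\gamma_R(X)$ is the minimum weight of such $f$. *)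

(* Defs.v *)
From HB Require Import structures.
From mathcomp Require Import all_boot.

Set Implicit Arguments.
Unset Strict Implicit.
Unset Printing Implicit Defensive.

Record sgraph := SGraph {
  vertex :> finType;
  adj : rel vertex;
  adj_sym : symmetric adj;
  adj_irrefl : irreflexive adj
}.

Definition isomorphic (G H : sgraph) : Prop :=
  exists2 phi : G -> H, bijective phi & {mono phi : x y / adj x y}.

Definition no_isolated (G : sgraph) : Prop := forall x : G, exists y : G, adj x y.

Definition nontrivial (G : sgraph) : Prop := 1 < #|G|.

Definition K2_adj : rel bool := fun b c => b != c.

Fact K2_sym : symmetric K2_adj.
Proof. by move=> b c; rewrite /K2_adj eq_sym. Qed.

Fact K2_irrefl : irreflexive K2_adj.
Proof. by move=> b; rewrite /K2_adj eqxx. Qed.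

Definition K2 : sgraph := SGraph K2_sym K2_irrefl.

Definition copies_adj (k : nat) (G : sgraph) : rel ('I_k * G)%type :=
  fun p q => (p.1 == q.1) && adj p.2 q.2.

Fact copies_sym (k : nat) (G : sgraph) : symmetric (@copies_adj k G).
Proof. by move=> p q; rewrite /copies_adj eq_sym adj_sym. Qed.

Fact copies_irrefl (k : nat) (G : sgraph) : irreflexive (@copies_adj k G).
Proof. by move=> p; rewrite /copies_adj adj_irrefl andbF. Qed.

Definition copies (k : nat) (G : sgraph) : sgraph :=
  SGraph (@copies_sym k G) (@copies_irrefl k G).

(* [k = 0] is allowed, so the graph without vertices counts as a disjoint
   union of copies of K_2. *)
Definition union_of_K2 (G : sgraph) : Prop :=
  exists k : nat, isomorphic G (copies k K2).

(* The pair (x, h) is the vertex h in the copy of H attached at x; the vertex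
   x of G is identified with (x, v). *)
Definition rooted_product_adj (G H : sgraph) (v : H) : rel (G * H)%type :=
  fun p q => ((p.1 == q.1) && adj p.2 q.2)
          || [&& p.2 == v, q.2 == v & adj p.1 q.1].

Fact rooted_product_sym (G H : sgraph) (v : H) :
  symmetric (@rooted_product_adj G H v).
Proof.
move=> p q; rewrite /rooted_product_adj eq_sym adj_sym (adj_sym p.1).
by rewrite (andbCA (p.2 == v)).
Qed.

Fact rooted_product_irrefl (G H : sgraph) (v : H) :
  irreflexive (@rooted_product_adj G H v).
Proof. by move=> p; rewrite /rooted_product_adj !adj_irrefl !andbF. Qed.

Definition rooted_product (G H : sgraph) (v : H) : sgraph :=
  SGraph (@rooted_product_sym G H v) (@rooted_product_irrefl G H v).

Definition del_vertex_adj (H : sgraph) (v : H) : rel {x : H | x != v} :=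
  fun x y => adj (val x) (val y).

Fact del_vertex_sym (H : sgraph) (v : H) : symmetric (@del_vertex_adj H v).
Proof. by move=> x y; apply: adj_sym. Qed.

Fact del_vertex_irrefl (H : sgraph) (v : H) :
  irreflexive (@del_vertex_adj H v).
Proof. by move=> x; apply: adj_irrefl. Qed.

Definition del_vertex (H : sgraph) (v : H) : sgraph :=
  SGraph (@del_vertex_sym H v) (@del_vertex_irrefl H v).

Definition roman_dominating (X : sgraph) (f : {ffun X -> 'I_3}) : bool :=
  [forall x : X, (f x == 0 :> nat) ==>
     [exists y : X, adj x y && (f y == 2 :> nat)]].

Definition weight (X : sgraph) (f : {ffun X -> 'I_3}) : nat :=
  \sum_(x : X) f x.

Definition const2 (X : sgraph) : {ffun X -> 'I_3} := [ffun=> ord_max].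

Fact const2_roman (X : sgraph) : roman_dominating (const2 X).
Proof. by apply/forallP => x; rewrite ffunE. Qed.

(* [const2 X] only witnesses that the set being minimised over is nonempty. *)
Definition gammaR (X : sgraph) : nat :=
  weight [arg min_(f < const2 X | roman_dominating f) weight f].

Lemma gammaR_min (X : sgraph) (f : {ffun X -> 'I_3}) :
  roman_dominating f -> gammaR X <= weight f.
Proof.
rewrite /gammaR; case: arg_minnP => [|g _ min_g]; first exact: const2_roman.
exact: min_g.
Qed.

Lemma gammaR_ex (X : sgraph) :
  exists2 f : {ffun X -> 'I_3}, roman_dominating f & weight f = gammaR X.
Proof.
rewrite /gammaR; case: arg_minnP => [|g rg _]; first exact: const2_roman.
by exists g.
Qed.

(* Main.v *)
(** Write n for the order of G, R for [gammaR H] and d for [gammaR (H - v)];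
always R <= d + 1.  A Roman dominating function on the rooted product restricts
on each copy of H either to a Roman dominating function of H, or to a function
vanishing at v, of weight at least d, whose root is dominated from inside G.

If d >= R then every copy weighs at least R, so (i) would give [gammaR G] >= n,
whereas a vertex of G with two neighbours gives [gammaR G] < n.  If d = R - 1
and a minimum function g on H has g v = 2, use g on the copies at the nonzero
vertices of a minimum function f on G and an optimal function of H - v
elsewhere: a copy at a vertex of value 2 costs only R instead of d + 2, and
such vertices exist since [gammaR G] < n.  Conversely, under (ii), a function f
on G lifts by writing f x at the root of copy x and an optimal function of
H - v on the rest; and truncating (weight of copy x) - d at 2 turns a function
on the product into one on G, because a copy whose root has value 2 weighs at
least R + 1 = d + 2. *)

Require Import Defs.
From mathcomp Require Import all_boot zify.

Set Implicit Arguments.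
Unset Strict Implicit.
Unset Printing Implicit Defensive.

(** Stated at a single vertex because the restriction of a function to one copy of H may fail at the
    root alone. *)
Definition dominated (X : sgraph) (f : {ffun X -> 'I_3}) (x : X) : Prop :=
  f x = 0 :> nat -> exists2 y, adj x y & f y = 2 :> nat.

Lemma romanP (X : sgraph) (f : {ffun X -> 'I_3}) :
  reflect (forall x, dominated f x) (roman_dominating f).
Proof.
apply: (iffP forallP) => rf x; last first.
  apply/implyP => /eqP /rf[y xy fy]; apply/existsP; exists y.
  by rewrite xy fy eqxx.
move=> fx; have /implyP := rf x; rewrite fx => /(_ isT) /existsP[y].
by case/andP=> xy /eqP fy; exists y.
Qed.

(** * Disjoint unions of edges, and the strict bound obtained away from them *)

Section PerfectMatching.
Variables (G : sgraph) (m : G -> G).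
Hypothesis adj_m : forall x y : G, adj x y = (y == m x).

Lemma mate_involutive : involutive m.
Proof. by move=> x; apply/esym/eqP; rewrite -adj_m adj_sym adj_m. Qed.

Lemma mate_neq x : m x != x.
Proof. by rewrite eq_sym -adj_m adj_irrefl. Qed.

(** The enumeration order picks one endpoint of each edge, so this set counts the copies of [K2]. *)
Definition mate_reps : {set G} := [set x | enum_rank x < enum_rank (m x)].

Lemma mate_repsN x : (m x \in mate_reps) = (x \notin mate_reps).
Proof.
rewrite !inE mate_involutive -leqNgt ltn_neqAle.
by rewrite (inj_eq val_inj) (inj_eq enum_rank_inj) mate_neq.
Qed.

Definition edge_point (p : 'I_#|mate_reps| * bool) : G :=
  if p.2 then enum_val p.1 else m (enum_val p.1).

Lemma edge_point_rep p : (edge_point p \in mate_reps) = p.2.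
Proof.
by case: p => i [] /=; rewrite /edge_point /= ?mate_repsN enum_valP.
Qed.

Lemma edge_point_inj : injective edge_point.
Proof.
move=> p q epq; have := edge_point_rep p; rewrite epq edge_point_rep.
case: p q epq => i b [j c] /= + cb; rewrite {}cb /edge_point /=.
by case: b => [|/(inv_inj mate_involutive)] /enum_val_inj ->.
Qed.

Lemma edge_point_surj x : exists p, edge_point p == x.
Proof.
case: (boolP (x \in mate_reps)) => [xR | /[!(esym (mate_repsN x))] mxR].
  by exists (enum_rank_in xR x, true); rewrite /edge_point /= enum_rankK_in.
exists (enum_rank_in mxR (m x), false).
by rewrite /edge_point /= enum_rankK_in // mate_involutive.
Qed.

Lemma mate_union_of_K2 : union_of_K2 G.
Proof.
exists #|mate_reps|.
pose phi x : copies #|mate_reps| K2 := xchoose (edge_point_surj x).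
have phiK : cancel phi edge_point.
  by move=> x; apply/eqP; apply: (xchooseP (edge_point_surj x)).
have edgeK : cancel edge_point phi.
  by move=> p; apply: edge_point_inj; rewrite phiK.
exists phi; first by exists edge_point.
move=> x y; rewrite -{2}[x]phiK -{2}[y]phiK adj_m.
(* In these coordinates [m] flips the boolean, which is adjacency in [K2]. *)
have -> : m (edge_point (phi x)) = edge_point ((phi x).1, ~~ (phi x).2).
  by case: (phi x) => i []; rewrite /edge_point //= mate_involutive.
rewrite (inj_eq edge_point_inj); case: (phi x) (phi y) => [i b] [j c].
rewrite /= /copies_adj /= /K2_adj -pair_eqE /= eq_sym.
by congr (_ && _); case: b c => [] [].
Qed.

End PerfectMatching.

(** Otherwise every vertex has exactly one neighbour, and choosing it gives the map [m] of a perfect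
    matching. *)
Lemma exists_two_neighbours (G : sgraph) :
  no_isolated G -> ~ union_of_K2 G ->
  exists x y z : G, [/\ adj x y, adj x z & y != z].
Proof.
move=> hG nK2.
case: (boolP [exists x : G, [exists y : G, [exists z : G,
    [&& adj x y, adj x z & y != z]]]]).
  case/existsP=> x /existsP[y] /existsP[z] /and3P[xy xz yz].
  by exists x, y, z.
move=> nxyz; case: nK2.
have nbr (x : G) : exists y : G, adj x y by apply: hG.
apply: (@mate_union_of_K2 G (fun x => xchoose (nbr x))) => x y.
have xm := xchooseP (nbr x); apply/idP/eqP => [xy | -> //].
apply/eqP/negPn; apply: contraNN nxyz => ny.
apply/existsP; exists x; apply/existsP; exists y.
by apply/existsP; exists (xchoose (nbr x)); rewrite xy xm.
Qed.

(** Put 2 on a vertex x, 0 on two of its neighbours and 1 elsewhere: these three vertices cost 2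
    instead of 3. *)
Lemma gammaR_lt_card (G : sgraph) :
  no_isolated G -> ~ union_of_K2 G -> gammaR G < #|G|.
Proof.
move=> hG nK2; have [x [y [z [xy xz yz]]]] := exists_two_neighbours hG nK2.
pose f : {ffun G -> 'I_3} := [ffun u =>
  if u == x then inord 2 else if u \in [set y; z] then ord0 else inord 1].
have nyx : y != x by apply: contraTneq xy => ->; rewrite adj_irrefl.
have nzx : z != x by apply: contraTneq xz => ->; rewrite adj_irrefl.
have fx : f x = 2 :> nat by rewrite ffunE eqxx inordK.
have rf : roman_dominating f.
  apply/romanP => u; rewrite /dominated ffunE.
  case: ifP => [_|_]; first by rewrite inordK.
  case: ifP => [|_]; last by rewrite inordK.
  by case/set2P=> -> _; exists x; rewrite // adj_sym.
apply: leq_ltn_trans (gammaR_min rf) _.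
rewrite /weight (bigD1 x) //= (bigD1 y) //= (bigD1 z) ?nzx 1?eq_sym //=.
rewrite fx !ffunE (negPf nyx) (negPf nzx) !inE !eqxx orbT /=.
rewrite !add0n; set a := \sum_(_ | _) _.
rewrite -sum1_card (bigD1 x) //= (bigD1 y) //= (bigD1 z) ?nzx 1?eq_sym //=.
set b := (X in _ < 1 + (1 + (1 + X))).
suff : a <= b by lia.
apply: leq_sum => u /andP[/andP[ux uy] uz].
by rewrite ffunE (negPf ux) !inE (negPf uy) (negPf uz) inordK.
Qed.

(** * Roman domination in H compared with H - v *)

Section Root.
Variables (H : sgraph) (v : H).

Definition extend (g : {ffun del_vertex v -> 'I_3}) (c : 'I_3) :
    {ffun H -> 'I_3} :=
  [ffun h => if insub h is Some w then g w else c].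

Lemma extend_root g c : extend g c v = c.
Proof. by rewrite ffunE insubF // eqxx. Qed.

Lemma extend_val g c w : extend g c (val w) = g w.
Proof. by rewrite ffunE valK. Qed.

Lemma weight_root (f : {ffun H -> 'I_3}) :
  weight f = f v + \sum_(w : del_vertex v) f (val w).
Proof.
rewrite /weight (bigD1 v) //=; congr (_ + _).
rewrite (reindex_omap (val : del_vertex v -> H) insub) /=; last first.
  by move=> h hv; rewrite insubT.
by apply: eq_bigl => w; rewrite valK (valP w) eqxx.
Qed.

Lemma weight_extend g c : weight (extend g c) = c + weight g.
Proof.
rewrite weight_root extend_root; congr (_ + _).
by apply: eq_bigr => w _; rewrite extend_val.
Qed.

Lemma extend_dominated g c :
  roman_dominating g -> forall h, h != v -> dominated (extend g c) h.
Proof.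
move=> /romanP rg h hv; pose w : del_vertex v := Sub h hv.
rewrite -[h]/(val w) /dominated extend_val => /rg[u wu gu].
by exists (val u); rewrite ?extend_val.
Qed.

(** A root of value 0 dominates nothing, so deleting it preserves both domination and weight. *)
Lemma gammaR_del_vertex_min (f : {ffun H -> 'I_3}) :
  f v = 0 :> nat -> (forall h, h != v -> dominated f h) ->
  gammaR (del_vertex v) <= weight f.
Proof.
move=> fv df; pose g : {ffun del_vertex v -> 'I_3} := [ffun w => f (val w)].
have -> : weight f = weight g.
  by rewrite weight_root fv; apply: eq_bigr => w _; rewrite ffunE.
apply: gammaR_min; apply/romanP => w; rewrite /dominated ffunE.
case/(df _ (valP w)) => h wh fh.
have hv : h != v by apply: contra_eq_neq fh => ->; rewrite fv.
by exists (Sub h hv : del_vertex v); rewrite ?ffunE.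
Qed.

Lemma gammaR_le_del_vertex : gammaR H <= (gammaR (del_vertex v)).+1.
Proof.
have [g rg <-] := gammaR_ex (del_vertex v).
have <- : weight (extend g (inord 1)) = (weight g).+1.
  by rewrite weight_extend inordK.
apply: gammaR_min; apply/romanP => h.
have [->|hv] := eqVneq h v; last exact: extend_dominated.
by rewrite /dominated extend_root inordK.
Qed.

(** The zero function leaves the root undominated. This makes the subtraction in [gammaR H - 1]
    exact. *)
Lemma gammaR_gt0 : 0 < gammaR H.
Proof.
have [f /romanP rf <-] := gammaR_ex H; rewrite lt0n.
apply/eqP => /eqP; rewrite sum_nat_eq0 => /forallP f0.
by have [y _ fy] := rf v (eqP (f0 v)); have := f0 y; rewrite fy.
Qed.

End Root.

(** * Assembling functions on the product from its copies of H, and restricting them back *)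

Section RootedProduct.
Variables (G H : sgraph) (v : H).

Definition glue (k : G -> {ffun H -> 'I_3}) :
    {ffun rooted_product G v -> 'I_3} := [ffun p => k p.1 p.2].

Definition copy_at (F : {ffun rooted_product G v -> 'I_3}) (x : G) :
    {ffun H -> 'I_3} := [ffun h => F (x, h)].

Lemma weight_glue k : weight (glue k) = \sum_x weight (k x).
Proof.
rewrite /weight (pair_bigA _ (fun x h => k x h : nat)) /=.
by apply: eq_bigr => p _; rewrite ffunE.
Qed.

Lemma copy_atK F : glue (copy_at F) = F.
Proof. by apply/ffunP => -[x h]; rewrite !ffunE. Qed.

Lemma glue_roman k :
  (forall x h, h != v -> dominated (k x) h) ->
  (forall x, dominated (k x) v \/
     exists2 y, adj x y & k y v = 2 :> nat) ->
  roman_dominating (glue k).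
Proof.
move=> kN kv; apply/romanP => -[x h]; rewrite /dominated ffunE /= => k0.
have [dom|[[y xy ky] hv]] : dominated (k x) h \/
    (exists2 y, adj x y & k y h = 2 :> nat) /\ h = v.
- have [->|hv] := eqVneq h v; last by left; apply: kN.
  by case: (kv x); [left | right].
- have [y hy ky] := dom k0.
  by exists (x, y); rewrite ?ffunE //= /rooted_product_adj /= eqxx hy.
by exists (y, h); rewrite ?ffunE //= /rooted_product_adj /= hv eqxx xy orbT.
Qed.

Lemma copy_at_dominated F x h : roman_dominating F ->
  dominated (copy_at F x) h \/ [/\ h = v, copy_at F x v = 0 :> nat
    & exists2 y, adj x y & copy_at F y v = 2 :> nat].
Proof.
move/romanP => rF.
have [/eqP F0 | F0] := boolP (F (x, h) == 0 :> nat); last first.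
  by left; rewrite /dominated ffunE => /eqP; rewrite (negPf F0).
have [[y h'] /= /orP[/andP[/eqP /= <- hh']|]] := rF _ F0.
  by move=> Fy; left=> _; exists h'; rewrite ?ffunE.
case/and3P=> /= /eqP hv /eqP -> xy Fy; right; split; rewrite ?ffunE -?hv //.
by exists y; rewrite ?ffunE // hv.
Qed.

(** Only a root can be dominated from outside its copy. The neighbouring root that does so has value
    2, hence needs no outside help, and its own copy is Roman dominated. *)
Lemma copy_at_cases F x : roman_dominating F ->
  roman_dominating (copy_at F x) \/
  gammaR (del_vertex v) <= weight (copy_at F x) /\
  exists y, [/\ adj x y, copy_at F y v = 2 :> nat
               & roman_dominating (copy_at F y)].
Proof.
move=> rF.
have [dv|[_ F0 [y xy Fy]]] := copy_at_dominated x v rF.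
  left; apply/romanP => h.
  by have [//|[-> _ _]] := copy_at_dominated x h rF; apply: dv.
right; split.
  apply: gammaR_del_vertex_min F0 _ => h /eqP hv.
  by have [//|[]] := copy_at_dominated x h rF.
exists y; split=> //; apply/romanP => h.
by have [//|[_]] := copy_at_dominated y h rF; rewrite Fy.
Qed.

End RootedProduct.

Theorem theorem3p7 (G H : sgraph) (v : H)
    (hG : no_isolated G) (hGK2 : ~ union_of_K2 G) (hH : nontrivial H) :
  gammaR (rooted_product G v) = gammaR G + #|G| * (gammaR H - 1)
  <->
  gammaR (del_vertex v) = gammaR H - 1 /\
  (forall g : {ffun H -> 'I_3},
     roman_dominating g -> weight g = gammaR H -> g v <= 1).
Proof.
have ltG := gammaR_lt_card hG hGK2.
have R0 := gammaR_gt0 v; have dR := gammaR_le_del_vertex v.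
have sumD (a : G -> nat) c : \sum_x (a x + c) = \sum_x a x + #|G| * c.
  by rewrite big_split /= sum_nat_const.
have [e re we] := gammaR_ex (del_vertex v).
split=> [eqGH | [ed no2]].
  have ed : gammaR (del_vertex v) = gammaR H - 1.
    have [Rd|] := leqP (gammaR H) (gammaR (del_vertex v)); last by lia.
    (* With [eqGH] this bound would force [#|G| <= gammaR G], against [ltG]. *)
    suff : #|G| * gammaR H <= gammaR (rooted_product G v) by nia.
    have [F rF <-] := gammaR_ex (rooted_product G v).
    rewrite -(copy_atK F) weight_glue -sum_nat_const.
    apply: leq_sum => x _.
    have [/gammaR_min //|[dF _]] := copy_at_cases x rF.
    exact: leq_trans dF.
  split=> // g /romanP rg wg; rewrite leqNgt; apply/negP => gv2.
  have gv : g v = 2 :> nat by have := ltn_ord (g v); lia.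
  have [f /romanP rf wf] := gammaR_ex G.
  pose k x := if f x == 0 :> nat then extend e ord0 else g.
  have rk : roman_dominating (glue v k).
    apply: glue_roman => [x h hv|x]; rewrite /k.
      by case: ifP => // _; apply: extend_dominated.
    case: ifP => [/eqP /rf[y xy fy]|_]; last by left; apply: rg.
    by right; exists y; rewrite // fy.
  (* Weight below the order of G forces a value 0, whose dominator has value 2. *)
  have [y fy] : exists y, f y = 2 :> nat.
    have /existsP[x /eqP /rf[y _ fy]] : [exists x, f x == 0 :> nat].
      apply: contraTT ltG => /existsPn nf; rewrite -leqNgt -wf -sum1_card.
      by apply: leq_sum => x _; rewrite lt0n.
    by exists y.
  have wk x : weight (k x) = (f x != 0 :> nat) + (gammaR H - 1).
    rewrite /k; case: ifP => _; last by rewrite wg; lia.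
    by rewrite weight_extend we ed.
  suff lt_f : \sum_x (f x != 0 :> nat) < gammaR G.
    have := gammaR_min rk; rewrite weight_glue (eq_bigr _ (fun x _ => wk x)).
    by rewrite sumD eqGH; lia.
  rewrite -wf /weight (bigD1 y) //= [X in _ < X](bigD1 y) //= fy.
  by rewrite ltnS leq_add2l; apply: leq_sum => x _; case: (f x) => -[].
apply/eqP; rewrite eqn_leq; apply/andP; split.
  have [f /romanP rf wf] := gammaR_ex G.
  pose k x := extend e (f x).
  have rk : roman_dominating (glue v k).
    apply: glue_roman => [x h|x]; first exact: extend_dominated.
    rewrite /dominated /k extend_root.
    have [/eqP /rf[y xy fy]|/eqP fx] := boolP (f x == 0 :> nat); last by left.
    by right; exists y; rewrite ?extend_root.
  apply: leq_trans (gammaR_min rk) _; rewrite weight_glue -wf -sumD.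
  by apply: leq_sum => x _; rewrite weight_extend we ed.
have [F rF <-] := gammaR_ex (rooted_product G v).
(* Every copy weighs at least [gammaR H - 1], so nothing is lost in this subtraction. *)
pose a x := weight (copy_at F x) - (gammaR H - 1).
pose f : {ffun G -> 'I_3} := [ffun x => inord (minn 2 (a x))].
have fE x : f x = minn 2 (a x) :> nat by rewrite ffunE inordK // ltnS geq_minl.
have rf : roman_dominating f.
  apply/romanP => x; rewrite /dominated fE => ax.
  (* A value 0 means that the copy weighs less than [gammaR H], so it is not Roman dominated on its
     own. *)
  have [/gammaR_min|[_ [y [xy Fy ry]]]] := copy_at_cases x rF.
    by move: ax; rewrite /a; lia.
  exists y => //; rewrite fE /a.
  (* By [no2], a copy with root value 2 cannot have weight exactly [gammaR H]; its excess is thus at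
     least 2. *)
  have := gammaR_min ry; have := no2 _ ry; rewrite Fy.
  by case: (eqVneq (weight (copy_at F y)) (gammaR H)) => [-> /(_ erefl)//|]; lia.
rewrite -(copy_atK F) weight_glue.
apply: leq_trans (_ : \sum_x (f x + (gammaR H - 1)) <= _).
  by rewrite sumD leq_add2r gammaR_min.
apply: leq_sum => x _; rewrite fE /a.
have [/gammaR_min|[+ _]] := copy_at_cases x rF; rewrite ?ed; lia.
Qed.
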